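(* Let $\mathcal{D}$ be an algebra of bounded real functions with the Stone property containing a strictly positive function $\chi>0$, and let $(L,\mathcal{D})$ be a Lagrangian. (i) If there exists a finite energy dominant measure $m$ for $(L,\mathcal{D})$, then every $\Gamma(f)$, $f\in\mathcal{D}$, is countably additive on $\alpha(\mathcal{S})$. (ii) If $(L,\mathcal{D})$ is energy separable with respect to $\{f_n\}_n\subset\mathcal{D}$ and every $\Gamma(f_n)$ is countably additive on $\alpha(\mathcal{S})$, then $\nu(A):=\sum_{n=1}^\infty2^{-n}\frac{\Gamma(f_n)(A)}{1+\Gamma(f_n)(X)}$, $A\in\alpha(\mathcal{S})$, is a finite energy dominant measure for $(L,\mathcal{D})$.
   Context: Lagrangian: symmetric bilinear map $(f,g)\mapsto L_{f,g}$ into the dual of $(\mathcal{D},\|\cdot\|_{\sup})$, each $L_f:=L_{f,f}$ positive, $L_f-L_{T_1(f)}$ positive, $T_1(x)=\max(x,0)\wedge1$. $\mathcal{S}=\{\{g>0\}:g\in\mathcal{D}\}$, $\alpha(\mathcal{S})$ the generated algebra. $\Gamma(f)(B):=\sup\{L_f(h):h\in\mathcal{D},0\le h\le\mathbf 1_B\}$ for $B\in\mathcal{S}$, $\Gamma(f)(A):=\inf\{\Gamma(f)(B):A\subset B\in\mathcal{S}\}$; on $\alpha(\mathcal{S})$ it is a finite finitely additive measure. A measure is a countably additive set function. For finitely additive $\mu,\nu$ on $\alpha(\mathcal{S})$, $\nu\ll\mu$ means: for each $\varepsilon>0$ there is $\delta>0$ with $\nu(A)<\varepsilon$ whenever $\mu(A)<\delta$.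 A measure $m$ on $\alpha(\mathcal{S})$ is energy dominant if $\Gamma(f)\ll m$ for all $f\in\mathcal{D}$. $(L,\mathcal{D})$ is energy separable if there is a countable $\{f_n\}\subset\mathcal{D}$ with $\Gamma(f)\ll\nu$ for all $f$, $\nu$ as in the claim. *)

(* Defs.v *)
From Stdlib Require Import Reals Classical ClassicalEpsilon.
Open Scope R_scope.
Set Implicit Arguments.

Section Defs.
Variable X : Type.

Definition is_glb (E : R -> Prop) (m : R) : Prop :=
  (forall x, E x -> m <= x) /\ (forall b, (forall x, E x -> b <= x) -> b <= m).

Definition sup_R (E : R -> Prop) : R := epsilon (inhabits 0) (fun s => is_lub E s).
Definition inf_R (E : R -> Prop) : R := epsilon (inhabits 0) (fun s => is_glb E s).

Definition series (u : nat -> R) : R := epsilon (inhabits 0) (fun l => infinite_sum u l).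

Definition setX : X -> Prop := fun _ => True.
Definition indic (B : X -> Prop) (x : X) : R :=
  if excluded_middle_informative (B x) then 1 else 0.

Inductive alg_gen (S : (X -> Prop) -> Prop) : (X -> Prop) -> Prop :=
| ag_base A : S A -> alg_gen S A
| ag_full : alg_gen S setX
| ag_compl A : alg_gen S A -> alg_gen S (fun x => ~ A x)
| ag_union A B : alg_gen S A -> alg_gen S B -> alg_gen S (fun x => A x \/ B x)
| ag_ext A B : alg_gen S A -> (forall x, A x <-> B x) -> alg_gen S B.

Definition bounded_fun (f : X -> R) : Prop := exists M, forall x, Rabs (f x) <= M.

Definition bdd_function_algebra (D : (X -> R) -> Prop) : Prop :=
  (forall f, D f -> bounded_fun f) /\
  (forall f g, D f -> D g -> D (fun x => f x + g x)) /\
  (forall a f, D f -> D (fun x => a * f x)) /\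
  (forall f g, D f -> D g -> D (fun x => f x * g x)).

Definition stone_property (D : (X -> R) -> Prop) : Prop :=
  forall f, D f -> D (fun x => Rmin (f x) 1).

Definition T1 (t : R) : R := Rmin (Rmax t 0) 1.

Definition linear_on (D : (X -> R) -> Prop) (l : (X -> R) -> R) : Prop :=
  forall a b f g, D f -> D g -> l (fun x => a * f x + b * g x) = a * l f + b * l g.

Definition sup_bounded_on (D : (X -> R) -> Prop) (l : (X -> R) -> R) : Prop :=
  exists C, forall h M, D h -> (forall x, Rabs (h x) <= M) -> Rabs (l h) <= C * M.

Definition positive_on (D : (X -> R) -> Prop) (l : (X -> R) -> R) : Prop :=
  forall h, D h -> (forall x, 0 <= h x) -> 0 <= l h.

Definition Lagrangian (D : (X -> R) -> Prop) (L : (X -> R) -> (X -> R) -> (X -> R) -> R) : Prop :=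
  (forall f g, D f -> D g -> linear_on D (L f g) /\ sup_bounded_on D (L f g)) /\
  (forall f g h, D f -> D g -> D h -> L f g h = L g f h) /\
  (* bilinearity (linearity in the first argument; second by symmetry) *)
  (forall a b f f' g h, D f -> D f' -> D g -> D h ->
     L (fun x => a * f x + b * f' x) g h = a * L f g h + b * L f' g h) /\
  (* T1 o f is in D, so that L_{T1(f)} makes sense *)
  (forall f, D f -> D (fun x => T1 (f x))) /\
  (forall f, D f -> positive_on D (L f f)) /\
  (forall f, D f -> positive_on D
      (fun h => L f f h - L (fun x => T1 (f x)) (fun x => T1 (f x)) h)).

Definition S_of (D : (X -> R) -> Prop) (B : X -> Prop) : Prop :=
  exists g, D g /\ (forall x, B x <-> 0 < g x).

Definition GammaS (D : (X -> R) -> Prop) L (f : X -> R) (B : X -> Prop) : R :=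
  sup_R (fun r => exists h, D h /\ (forall x, 0 <= h x <= indic B x) /\ r = L f f h).

Definition Gamma (D : (X -> R) -> Prop) L (f : X -> R) (A : X -> Prop) : R :=
  inf_R (fun r => exists B, S_of D B /\ (forall x, A x -> B x) /\ r = GammaS D L f B).

Definition countably_additive (Alg : (X -> Prop) -> Prop) (mu : (X -> Prop) -> R) : Prop :=
  forall A : nat -> (X -> Prop),
    (forall n, Alg (A n)) ->
    (forall n m x, n <> m -> A n x -> A m x -> False) ->
    Alg (fun x => exists n, A n x) ->
    infinite_sum (fun n => mu (A n)) (mu (fun x => exists n, A n x)).

Definition finite_measure_on (Alg : (X -> Prop) -> Prop) (mu : (X -> Prop) -> R) : Prop :=
  (forall A, Alg A -> 0 <= mu A) /\ countably_additive Alg mu.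

Definition abs_cont (Alg : (X -> Prop) -> Prop) (nu mu : (X -> Prop) -> R) : Prop :=
  forall eps, 0 < eps -> exists delta, 0 < delta /\
    forall A, Alg A -> mu A < delta -> nu A < eps.

Definition energy_dominant (D : (X -> R) -> Prop) L (m : (X -> Prop) -> R) : Prop :=
  forall f, D f -> abs_cont (alg_gen (S_of D)) (Gamma D L f) m.

(* nu(A) = sum_{n>=1} 2^{-n} Gamma(f_n)(A) / (1 + Gamma(f_n)(X)); the sequence
   f_1, f_2, ... is represented by fs 0, fs 1, ... *)
Definition nu_of (D : (X -> R) -> Prop) L (fs : nat -> X -> R) (A : X -> Prop) : R :=
  series (fun n => (/2) ^ (S n) * (Gamma D L (fs n) A / (1 + Gamma D L (fs n) setX))).

Definition energy_separable (D : (X -> R) -> Prop) L (fs : nat -> X -> R) : Prop :=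
  (forall n, D (fs n)) /\
  (forall f, D f -> abs_cont (alg_gen (S_of D)) (Gamma D L f) (nu_of D L fs)).

End Defs.

(* Main.v *)
(** (i) A finite dominating measure [m] is continuous from above at the empty
    set, and absolute continuity passes this on to [Gamma(f)]. Continuity is
    what makes the content [B |-> sup { L_f(h) : 0 <= h <= 1_B }] strongly
    subadditive on [S]; without it additivity can fail, for example for
    [L_f(h) = f(1)^2 * lim h] on the convergent real sequences, where the even
    and the odd numbers both have content 0. Strong subadditivity passes to the
    outer content [Gamma(f)], which is therefore additive on the algebra of sets
    [A] with [Gamma(f)(A) + Gamma(f)(X \ A) = Gamma(f)(X)], and [chi > 0] is used
    to show that this algebra contains [S]. Additivity together with continuity
    at the empty set is countable additivity.

    (ii) [nu] is countably additive by interchanging two nonnegative series;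
    dominance is the hypothesis of energy separability. *)

Require Import Defs.
From Stdlib Require Import Reals Classical ClassicalEpsilon.
From Stdlib Require Import FunctionalExtensionality PropExtensionality Lra Lia.
Open Scope R_scope.

(** * Extensionality of sets, suprema and infima *)

Lemma set_ext (X : Type) (A B : X -> Prop) : (forall x, A x <-> B x) -> A = B.
Proof.
  intros H. apply functional_extensionality; intros x.
  apply propositional_extensionality, H.
Qed.

(** [sup_R] is an arbitrary real unless a least upper bound exists; the member [r0] and the bound
    [C] secure existence by completeness. *)
Lemma sup_R_lub (E : R -> Prop) (C r0 : R) :
  E r0 -> (forall x, E x -> x <= C) -> is_lub E (sup_R E).
Proof.
  intros H0 HC. unfold sup_R. apply epsilon_spec.
  destruct (completeness E) as [l Hl].
  - exists C. exact HC.
  - exists r0. exact H0.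
  - exists l. exact Hl.
Qed.

Lemma inf_R_glb (E : R -> Prop) (C r0 : R) :
  E r0 -> (forall x, E x -> C <= x) -> is_glb E (inf_R E).
Proof.
  intros H0 HC. unfold inf_R. apply epsilon_spec.
  destruct (completeness (fun r => E (- r))) as [l [Hl1 Hl2]].
  - exists (- C). intros x Hx. apply HC in Hx. lra.
  - exists (- r0). rewrite Ropp_involutive. exact H0.
  - exists (- l). split.
    + intros x Hx. enough (- x <= l) by lra. apply Hl1. rewrite Ropp_involutive. exact Hx.
    + intros b Hb. enough (l <= - b) by lra. apply Hl2.
      intros x Hx. apply Hb in Hx. lra.
Qed.

Lemma le_eps (a b c : R) :
  0 <= c -> (forall eps, 0 < eps -> a <= b + c * eps) -> a <= b.
Proof.
  intros Hc H. destruct (Rle_or_lt a b) as [|Hlt]; [assumption|exfalso].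
  (* With this [eps] the error [c * eps] stays below [a - b]; the summand 1 covers the case
     [c = 0]. *)
  assert (Hq : 0 < (a - b) / (2 * (c + 1))) by (apply Rdiv_lt_0_compat; lra).
  specialize (H _ Hq).
  assert (E : (a - b) / (2 * (c + 1)) * (2 * (c + 1)) = a - b) by (field; lra).
  nra.
Qed.

(** * Series *)

Lemma Un_cv_const (c : R) : Un_cv (fun _ => c) c.
Proof.
  intros eps He. exists 0%nat. intros n _. unfold Rdist.
  rewrite Rminus_diag, Rabs_R0. exact He.
Qed.

Lemma infinite_sum_shift (u : nat -> R) (l : R) :
  infinite_sum u l -> infinite_sum (fun n => u (S n)) (l - u 0%nat).
Proof.
  intros H eps He. destruct (H eps He) as [N HN]. exists N. intros n Hn.
  specialize (HN (S n) ltac:(lia)).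
  rewrite decomp_sum in HN by lia. simpl pred in HN. unfold Rdist in *.
  replace (sum_f_R0 (fun n => u (S n)) n - (l - u 0%nat))
    with (u 0%nat + sum_f_R0 (fun i => u (S i)) n - l) by ring. exact HN.
Qed.

Lemma infinite_sum_pos_le (u : nat -> R) (l : R) (n : nat) :
  (forall k, 0 <= u k) -> infinite_sum u l -> sum_f_R0 u n <= l.
Proof. intros Hu H. exact (sum_incr u n l H Hu). Qed.

Lemma sum_f_R0_cv (u : nat -> nat -> R) (l : nat -> R) (K : nat) :
  (forall k, Un_cv (u k) (l k)) ->
  Un_cv (fun n => sum_f_R0 (fun k => u k n) K) (sum_f_R0 l K).
Proof.
  intros H. induction K as [|K IH]; simpl; [apply H|].
  apply CV_plus; [exact IH | apply H].
Qed.

Lemma sum_f_R0_exchange (u : nat -> nat -> R) (K N : nat) :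
  sum_f_R0 (fun k => sum_f_R0 (u k) N) K =
  sum_f_R0 (fun n => sum_f_R0 (fun k => u k n) K) N.
Proof.
  induction K as [|K IH]; simpl; [reflexivity|].
  rewrite IH, <- sum_plus. reflexivity.
Qed.

(** Tonelli for double series. Each partial sum of [V] is a limit of sums over finite rectangles,
    all at most [T]. Conversely, finitely many rows nearly exhaust [T], finitely many columns nearly
    exhaust those rows, and that rectangle lies below a partial sum of [V]. *)
Lemma infinite_sum_exchange (u : nat -> nat -> R) (U V : nat -> R) (T : R) :
  (forall k n, 0 <= u k n) ->
  (forall k, infinite_sum (u k) (U k)) ->
  infinite_sum U T ->
  (forall n, infinite_sum (fun k => u k n) (V n)) ->
  infinite_sum V T.
Proof.
  intros Hu HU HT HV eps He.
  assert (HU0 : forall k, 0 <= U k).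
  { intros k. apply Rle_trans with (sum_f_R0 (u k) 0); [apply Hu|].
    apply infinite_sum_pos_le; auto. }
  assert (Hpart : forall N, Un_cv (fun K => sum_f_R0 (fun n => sum_f_R0 (fun k => u k n) K) N)
                              (sum_f_R0 V N)).
  { intros N. apply (sum_f_R0_cv (fun n K => sum_f_R0 (fun k => u k n) K)). exact HV. }
  assert (Hub : forall N, sum_f_R0 V N <= T).
  { intros N. refine (Rle_cv_lim _ (Hpart N) HT).
    intros K. rewrite <- sum_f_R0_exchange. apply sum_Rle. intros k _.
    apply infinite_sum_pos_le; auto. }
  destruct (HT (eps / 2) ltac:(lra)) as [K HK].
  specialize (HK K ltac:(lia)). apply Rabs_def2 in HK.
  destruct (sum_f_R0_cv (fun k N => sum_f_R0 (u k) N) U K HU (eps / 2) ltac:(lra)) as [N HN].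
  exists N. intros n Hn. specialize (HN n Hn). apply Rabs_def2 in HN.
  cbv beta in HN. rewrite sum_f_R0_exchange in HN.
  assert (Hlow : sum_f_R0 (fun n => sum_f_R0 (fun k => u k n) K) n <= sum_f_R0 V n).
  { apply sum_Rle. intros j _. apply (infinite_sum_pos_le (fun k => u k j)); auto. }
  specialize (Hub n). apply Rabs_def1; lra.
Qed.

(** * Algebras of sets and finitely additive set functions *)

Lemma alg_gen_inter (X : Type) (S : (X -> Prop) -> Prop) (A B : X -> Prop) :
  alg_gen S A -> alg_gen S B -> alg_gen S (fun x => A x /\ B x).
Proof.
  intros HA HB. apply ag_ext with (fun x => ~ (~ A x \/ ~ B x)).
  - apply ag_compl, ag_union; apply ag_compl; assumption.
  - intros x. tauto.
Qed.

Lemma alg_gen_diff (X : Type) (S : (X -> Prop) -> Prop) (A B : X -> Prop) :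
  alg_gen S A -> alg_gen S B -> alg_gen S (fun x => A x /\ ~ B x).
Proof. intros HA HB. apply alg_gen_inter; [|apply ag_compl]; assumption. Qed.

Definition monotone_set_fun {X : Type} (mu : (X -> Prop) -> R) : Prop :=
  forall A B, (forall x, A x -> B x) -> mu A <= mu B.

(** Also known as submodularity. It is used for two classes: the sets in [S_of D] for the content,
    and all subsets for the outer content. *)
Definition strongly_subadditive {X : Type} (Alg : (X -> Prop) -> Prop)
    (mu : (X -> Prop) -> R) : Prop :=
  forall A B, Alg A -> Alg B ->
    mu (fun x => A x \/ B x) + mu (fun x => A x /\ B x) <= mu A + mu B.

Definition finitely_additive {X : Type} (Alg : (X -> Prop) -> Prop)
    (mu : (X -> Prop) -> R) : Prop :=
  forall A B, Alg A -> Alg B -> (forall x, A x -> B x -> False) ->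
    mu (fun x => A x \/ B x) = mu A + mu B.

Definition continuous_at_empty {X : Type} (Alg : (X -> Prop) -> Prop)
    (mu : (X -> Prop) -> R) : Prop :=
  forall E : nat -> X -> Prop,
    (forall n, Alg (E n)) ->
    (forall n x, E (S n) x -> E n x) ->
    (forall x, ~ forall n, E n x) ->
    Un_cv (fun n => mu (E n)) 0.

(** [E N] is the disjoint union of the shells [d (N + n)]. Comparing the sums that start at [N] and
    at [S N] gives [mu (E (S N)) = mu (E N) - mu (d N)] without a detour through finite additivity.
    The partial sums of the shells then telescope. *)
Lemma countably_additive_continuous_at_empty (X : Type) (S0 : (X -> Prop) -> Prop)
    (mu : (X -> Prop) -> R) :
  countably_additive (alg_gen S0) mu -> continuous_at_empty (alg_gen S0) mu.
Proof.
  intros Hmu E HE Hdec Hemp.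
  set (d := fun n x => E n x /\ ~ E (S n) x).
  assert (Hle : forall n k x, E (k + n)%nat x -> E n x).
  { intros n k x. induction k as [|k IH]; simpl; auto. }
  assert (Hd : forall n, alg_gen S0 (d n)) by (intros n; apply alg_gen_diff; auto).
  assert (Hdisj : forall n m x, (n < m)%nat -> d n x -> d m x -> False).
  { intros n m x Hnm [_ H1] [H2 _]. apply H1.
    apply (Hle _ (m - S n)%nat). replace (m - S n + S n)%nat with m by lia. exact H2. }
  assert (Hun : forall N, (fun x => exists n, d (N + n)%nat x) = E N).
  { intros N. apply set_ext. intros x. split.
    - intros [n [Hn _]]. apply (Hle N n). rewrite Nat.add_comm. exact Hn.
    (* A point of [E N] in none of the later shells stays in every [E (N + k)], against the empty
       intersection. *)
    - intros HN. apply NNPP. intros Hno. apply (Hemp x).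
      assert (Hup : forall k, E (N + k)%nat x).
      { induction k as [|k IH]; [rewrite Nat.add_0_r; exact HN|].
        apply NNPP. intros H. apply Hno. exists k. split; [exact IH|].
        rewrite <- Nat.add_succ_r. exact H. }
      intros n. apply (Hle n N). apply Hup. }
  assert (Hsum : forall N, infinite_sum (fun n => mu (d (N + n)%nat)) (mu (E N))).
  { intros N. rewrite <- (Hun N). apply (Hmu (fun n => d (N + n)%nat)).
    - intros n. apply Hd.
    - intros n m x Hnm. destruct (Nat.lt_total n m) as [H|[H|H]]; [|contradiction|].
      + apply Hdisj. lia.
      + intros H1 H2. apply (Hdisj (N + m)%nat (N + n)%nat x); [lia|assumption..].
    - rewrite Hun. apply HE. }
  assert (Hstep : forall N, mu (E (S N)) = mu (E N) - mu (d N)).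
  { intros N. apply uniqueness_sum with (fun n => mu (d (S N + n)%nat)); [apply Hsum|].
    pose proof (infinite_sum_shift _ _ (Hsum N)) as H. cbv beta in H.
    rewrite Nat.add_0_r in H.
    replace (fun n => mu (d (S N + n)%nat)) with (fun n => mu (d (N + S n)%nat)); [exact H|].
    apply functional_extensionality. intros n. rewrite Nat.add_succ_r. reflexivity. }
  assert (Hpart : forall N, sum_f_R0 (fun n => mu (d n)) N = mu (E 0%nat) - mu (E (S N))).
  { induction N as [|N IH]; simpl; rewrite ?IH, !Hstep; ring. }
  intros eps He. destruct (Hsum 0%nat eps He) as [N HN].
  exists (S N). intros n Hn. destruct n as [|n]; [lia|].
  specialize (HN n ltac:(lia)). simpl in HN. rewrite Hpart in HN.
  unfold Rdist in *.
  replace (mu (E 0%nat) - mu (E (S n)) - mu (E 0%nat)) with (- mu (E (S n))) in HN by ring.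
  rewrite Rabs_Ropp in HN. rewrite Rminus_0_r. exact HN.
Qed.

Lemma continuous_at_empty_countably_additive (X : Type) (S0 : (X -> Prop) -> Prop)
    (mu : (X -> Prop) -> R) :
  finitely_additive (alg_gen S0) mu -> continuous_at_empty (alg_gen S0) mu ->
  countably_additive (alg_gen S0) mu.
Proof.
  intros Hadd Hcont A HA Hdisj HU.
  (* The remainder is the full union with finitely many sets removed, so it lies in the algebra by
     induction from [HU]; it decreases to the empty set. *)
  set (r := fun N x => (exists n, A n x) /\ forall n, (n < N)%nat -> ~ A n x).
  assert (Hr0 : r 0%nat = fun x => exists n, A n x).
  { apply set_ext. intros x. unfold r. split; [tauto|]. intros H. split; [exact H|].
    intros n Hn. lia. }
  assert (HrS : forall N, r (S N) = fun x => r N x /\ ~ A N x).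
  { intros N. apply set_ext. intros x. unfold r. split.
    - intros [H1 H2]. repeat split; auto.
    - intros [[H1 H2] H3]. split; [exact H1|]. intros n Hn.
      destruct (Nat.eq_dec n N) as [->|]; [exact H3|]. apply H2. lia. }
  assert (Hr : forall N, alg_gen S0 (r N)).
  { induction N as [|N IH]; [rewrite Hr0; exact HU|].
    rewrite HrS. apply alg_gen_diff; auto. }
  assert (Hstep : forall N, mu (r N) = mu (A N) + mu (r (S N))).
  { intros N. rewrite <- Hadd; auto.
    - f_equal. apply set_ext. intros x. rewrite HrS. split; [tauto|].
      intros [H|H]; [|tauto]. split; [exists N; exact H|].
      intros n Hn Hn'. apply (Hdisj n N x); [lia|assumption..].
    - rewrite HrS. tauto. }
  assert (Hpart : forall N, sum_f_R0 (fun n => mu (A n)) N = mu (r 0%nat) - mu (r (S N))).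
  { induction N as [|N IH]; simpl.
    - rewrite (Hstep 0%nat). ring.
    - rewrite IH, (Hstep (S N)). ring. }
  rewrite <- Hr0. intros eps He.
  destruct (Hcont r Hr) with (eps := eps) as [N HN]; [| |exact He|].
  - intros n x. rewrite HrS. tauto.
  - intros x H. destruct (H 0%nat) as [[n Hn] _]. destruct (H (S n)) as [_ H'].
    apply (H' n); [lia|exact Hn].
  - exists N. intros n Hn. specialize (HN (S n) ltac:(lia)). rewrite Hpart.
    unfold Rdist in *. rewrite Rminus_0_r in HN.
    replace (mu (r 0%nat) - mu (r (S n)) - mu (r 0%nat)) with (- mu (r (S n))) by ring.
    rewrite Rabs_Ropp. exact HN.
Qed.

(* Adding strong subadditivity for [A], [B] to that for their complements
   forces equality, so the sets split by [mu] form an algebra. *)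
Lemma strongly_subadditive_finitely_additive (X : Type) (S0 : (X -> Prop) -> Prop)
    (mu : (X -> Prop) -> R) :
  strongly_subadditive (fun _ => True) mu ->
  mu (fun _ => False) = 0 ->
  (forall A, S0 A -> mu A + mu (fun x => ~ A x) <= mu (@setX X)) ->
  finitely_additive (alg_gen S0) mu.
Proof.
  intros Hss H0 HS.
  assert (Hge : forall A, mu (@setX X) <= mu A + mu (fun x => ~ A x)).
  { intros A. pose proof (Hss A (fun x => ~ A x) I I) as H. cbv beta in H.
    replace (fun x => A x \/ ~ A x) with (@setX X) in H
      by (apply set_ext; intros x; unfold setX; tauto).
    replace (fun x => A x /\ ~ A x) with (fun _ : X => False) in H
      by (apply set_ext; intros x; tauto).
    lra. }
  assert (Hmod : forall A B,
    mu A + mu (fun x => ~ A x) = mu (@setX X) ->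
    mu B + mu (fun x => ~ B x) = mu (@setX X) ->
    mu (fun x => A x \/ B x) + mu (fun x => ~ (A x \/ B x)) = mu (@setX X) /\
    mu (fun x => A x \/ B x) + mu (fun x => A x /\ B x) = mu A + mu B).
  { intros A B HA HB.
    pose proof (Hss A B I I) as H1. cbv beta in H1.
    pose proof (Hss (fun x => ~ A x) (fun x => ~ B x) I I) as H2.
    pose proof (Hge (fun x => A x \/ B x)) as H3.
    pose proof (Hge (fun x => A x /\ B x)) as H4.
    cbv beta in H2.
    replace (fun x => ~ A x \/ ~ B x) with (fun x => ~ (A x /\ B x)) in H2
      by (apply set_ext; intros x; tauto).
    replace (fun x => ~ A x /\ ~ B x) with (fun x => ~ (A x \/ B x)) in H2
      by (apply set_ext; intros x; tauto).
    lra. }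
  assert (Hsplit : forall A, alg_gen S0 A -> mu A + mu (fun x => ~ A x) = mu (@setX X)).
  { intros A HA. induction HA as [A HA| |A HA IH|A B HA IHA HB IHB|A B HA IH HAB].
    - apply Rle_antisym; auto.
    - replace (fun x => ~ @setX X x) with (fun _ : X => False)
        by (apply set_ext; intros x; unfold setX; tauto).
      lra.
    - replace (fun x => ~ ~ A x) with A by (apply set_ext; intros x; tauto). lra.
    - apply Hmod; assumption.
    - rewrite <- (set_ext X A B HAB). exact IH. }
  intros A B HA HB Hdisj.
  destruct (Hmod A B (Hsplit A HA) (Hsplit B HB)) as [_ H].
  replace (fun x => A x /\ B x) with (fun _ : X => False) in H; [lra|].
  apply set_ext. intros x. split; [tauto|]. intros [H1 H2]. exact (Hdisj x H1 H2).
Qed.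

(** * The outer content of a positive functional *)

(** Trades the case distinction in [indic] for a bound by 1 and a support condition, the two clauses
    of [subordinate] below. *)
Lemma indic_bounds (X : Type) (B : X -> Prop) (x : X) (r : R) :
  0 <= r <= indic B x <-> 0 <= r <= 1 /\ (0 < r -> B x).
Proof.
  unfold indic. destruct (excluded_middle_informative (B x)) as [H|H]; split.
  - tauto.
  - tauto.
  - intros Hr. split; [lra|]. intros. lra.
  - intros [Hr Hb]. split; [lra|]. destruct (Rle_or_lt r 0); [assumption|tauto].
Qed.

Section Content.

Variables (X : Type) (D : (X -> R) -> Prop) (L : (X -> R) -> (X -> R) -> (X -> R) -> R).
Variables (f chi : X -> R).
Hypotheses (HD : bdd_function_algebra D) (HT1 : forall g, D g -> D (fun x => T1 (g x))).
Hypotheses (Hchi : D chi) (Hchipos : forall x, 0 < chi x).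
Hypotheses (Hlin : linear_on D (L f f)) (Hbdd : sup_bounded_on D (L f f)).
Hypothesis (Hpos : positive_on D (L f f)).

Let l : (X -> R) -> R := L f f.
Let v : (X -> Prop) -> R := GammaS D L f.
Let gam : (X -> Prop) -> R := Gamma D L f.

(** * Lattice operations in [D] and monotonicity of [l] *)

Lemma D_lincomb a b g h : D g -> D h -> D (fun x => a * g x + b * h x).
Proof.
  destruct HD as (_ & Hadd & Hscal & _). intros Hg Hh. exact (Hadd _ _ (Hscal a g Hg) (Hscal b h Hh)).
Qed.

Lemma D_ext g h : D g -> (forall x, g x = h x) -> D h.
Proof. intros Hg H. apply functional_extensionality in H. rewrite <- H. exact Hg. Qed.

Lemma D_plus g h : D g -> D h -> D (fun x => g x + h x).
Proof. intros Hg Hh. apply (D_ext _ _ (D_lincomb 1 1 g h Hg Hh)). intros; ring. Qed.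

Lemma D_minus g h : D g -> D h -> D (fun x => g x - h x).
Proof. intros Hg Hh. apply (D_ext _ _ (D_lincomb 1 (-1) g h Hg Hh)). intros; ring. Qed.

Lemma D_scal a g : D g -> D (fun x => a * g x).
Proof. apply (proj1 (proj2 (proj2 HD))). Qed.

Lemma D_zero : D (fun _ => 0).
Proof. apply (D_ext _ _ (D_scal 0 chi Hchi)). intros; ring. Qed.

(* [g^+ = M * T1 (g / M)] once [M] bounds [g]. *)
Lemma D_pos_part g : D g -> D (fun x => Rmax (g x) 0).
Proof.
  intros Hg. destruct (proj1 HD g Hg) as [M HM].
  set (C := Rabs M + 1).
  assert (HC : 0 < C) by (unfold C; pose proof (Rabs_pos M); lra).
  apply (D_ext _ _ (D_scal C _ (HT1 _ (D_scal (/ C) _ Hg)))).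
  intros x. assert (Hx : g x <= C).
  { unfold C. pose proof (HM x). pose proof (Rle_abs (g x)). pose proof (Rle_abs M). lra. }
  assert (E : g x = C * (/ C * g x)) by (field; lra).
  unfold T1. rewrite E in Hx at 1. rewrite E at 2. set (y := / C * g x) in *.
  unfold Rmin, Rmax. repeat destruct Rle_dec; nra.
Qed.

Lemma D_max g h : D g -> D h -> D (fun x => Rmax (g x) (h x)).
Proof.
  intros Hg Hh. apply (D_ext _ _ (D_plus _ _ Hh (D_pos_part _ (D_minus _ _ Hg Hh)))).
  intros x. unfold Rmax. repeat destruct Rle_dec; lra.
Qed.

Lemma D_min g h : D g -> D h -> D (fun x => Rmin (g x) (h x)).
Proof.
  intros Hg Hh. apply (D_ext _ _ (D_minus _ _ Hg (D_pos_part _ (D_minus _ _ Hg Hh)))).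
  intros x. unfold Rmax, Rmin. repeat destruct Rle_dec; lra.
Qed.

Lemma l_plus g h : D g -> D h -> l (fun x => g x + h x) = l g + l h.
Proof.
  intros Hg Hh. rewrite <- (Rmult_1_l (l g)), <- (Rmult_1_l (l h)).
  unfold l. rewrite <- (Hlin 1 1 g h Hg Hh). f_equal.
  apply functional_extensionality. intros x. ring.
Qed.

Lemma l_scal a g : D g -> l (fun x => a * g x) = a * l g.
Proof.
  intros Hg. replace (a * l g) with (a * l g + 0 * l g) by ring.
  unfold l. rewrite <- (Hlin a 0 g g Hg Hg). f_equal.
  apply functional_extensionality. intros x. ring.
Qed.

Lemma l_zero : l (fun _ => 0) = 0.
Proof.
  replace (fun _ : X => 0) with (fun x => 0 * chi x)
    by (apply functional_extensionality; intros; ring).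
  rewrite l_scal by exact Hchi. ring.
Qed.

Lemma l_le g h : D g -> D h -> (forall x, g x <= h x) -> l g <= l h.
Proof.
  intros Hg Hh Hle.
  assert (H : 0 <= l (fun x => h x - g x)).
  { apply Hpos; [apply D_minus; assumption|]. intros x. specialize (Hle x). lra. }
  assert (E : l h = l (fun x => h x - g x) + l g).
  { rewrite <- l_plus; [|apply D_minus; assumption|assumption]. f_equal.
    apply functional_extensionality. intros x. ring. }
  lra.
Qed.

(** * The lattice of sets [S_of D] *)

Lemma S_of_nonneg B :
  S_of D B -> exists g, D g /\ (forall x, 0 <= g x) /\ forall x, B x <-> 0 < g x.
Proof.
  intros [g [Hg HB]]. exists (fun x => Rmax (g x) 0). split; [|split].
  - apply D_pos_part, Hg.
  - intros x. apply Rmax_r.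
  - intros x. rewrite HB. unfold Rmax. destruct Rle_dec; lra.
Qed.

Lemma S_of_setX : S_of D (@setX X).
Proof.
  exists chi. split; [exact Hchi|]. intros x. split; [intros; apply Hchipos|].
  intros; exact I.
Qed.

Lemma S_of_empty : S_of D (fun _ => False).
Proof. exists (fun _ => 0). split; [apply D_zero|]. intros x. lra. Qed.

Lemma S_of_union A B : S_of D A -> S_of D B -> S_of D (fun x => A x \/ B x).
Proof.
  intros [g [Hg HA]] [h [Hh HB]]. exists (fun x => Rmax (g x) (h x)).
  split; [apply D_max; assumption|]. intros x. rewrite HA, HB.
  unfold Rmax. destruct Rle_dec; lra.
Qed.

Lemma S_of_inter A B : S_of D A -> S_of D B -> S_of D (fun x => A x /\ B x).
Proof.
  intros [g [Hg HA]] [h [Hh HB]]. exists (fun x => Rmin (g x) (h x)).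
  split; [apply D_min; assumption|]. intros x. rewrite HA, HB.
  unfold Rmin. destruct Rle_dec; lra.
Qed.

(** * The inner content [v] and its outer extension [gam] *)

Definition subordinate (h : X -> R) (B : X -> Prop) : Prop :=
  D h /\ (forall x, 0 <= h x <= 1) /\ (forall x, 0 < h x -> B x).

(** Valid for every set [B]: the zero function is subordinate to it, and sup-boundedness of [l] on
    functions bounded by 1 caps the values at [C]. *)
Lemma GammaS_is_lub B : is_lub (fun r => exists h, subordinate h B /\ r = l h) (v B).
Proof.
  assert (E : (fun r => exists h, subordinate h B /\ r = l h) =
              (fun r => exists h, D h /\ (forall x, 0 <= h x <= indic B x) /\ r = L f f h)).
  { apply set_ext. intros r. split.
    - intros [h [[H1 [H2 H3]] H4]]. exists h. repeat split; try assumption;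
        apply (indic_bounds _ B x (h x)); split; auto.
    - intros [h [H1 [H2 H3]]]. exists h. split; [|exact H3]. split; [exact H1|].
      split; intros x; apply (indic_bounds _ B x (h x)); auto. }
  unfold v, GammaS. rewrite <- E.
  destruct Hbdd as [C HC].
  apply sup_R_lub with (C := C * 1) (r0 := l (fun _ => 0)).
  - exists (fun _ => 0). split; [|reflexivity]. split; [apply D_zero|].
    split; intros x; lra.
  - intros r [h [[H1 [H2 _]] ->]]. apply Rle_trans with (1 := Rle_abs _).
    apply HC; [exact H1|]. intros x. specialize (H2 x). rewrite Rabs_pos_eq; lra.
Qed.

Lemma GammaS_ge B h : subordinate h B -> l h <= v B.
Proof. intros H. apply (proj1 (GammaS_is_lub B)). exists h. auto. Qed.

Lemma GammaS_le B c : (forall h, subordinate h B -> l h <= c) -> v B <= c.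
Proof.
  intros H. apply (proj2 (GammaS_is_lub B)). intros r [h [Hh ->]]. auto.
Qed.

Lemma GammaS_approx B eps : 0 < eps -> exists h, subordinate h B /\ v B - eps < l h.
Proof.
  intros He. apply NNPP. intros Hno.
  enough (v B <= v B - eps) by lra.
  apply GammaS_le. intros h Hh. apply Rnot_lt_le. intros H. apply Hno. exists h. auto.
Qed.

Lemma GammaS_mono A B : (forall x, A x -> B x) -> v A <= v B.
Proof.
  intros H. apply GammaS_le. intros h (H1 & H2 & H3). apply GammaS_ge.
  repeat split; auto; apply H2.
Qed.

Lemma GammaS_empty : v (fun _ => False) = 0.
Proof.
  apply Rle_antisym.
  - apply GammaS_le. intros h (H1 & H2 & H3). rewrite <- l_zero.
    apply l_le; [exact H1|exact D_zero|]. intros x.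
    apply Rnot_lt_le. exact (H3 x).
  - rewrite <- l_zero. apply GammaS_ge. split; [exact D_zero|]. split; intros x; lra.
Qed.

Lemma GammaS_nonneg B : 0 <= v B.
Proof. rewrite <- GammaS_empty. apply GammaS_mono. tauto. Qed.

(** Every set has a cover in [S_of D], since [chi > 0] makes the whole space a member; 0 is a lower
    bound. *)
Lemma Gamma_is_glb A :
  is_glb (fun r => exists B, S_of D B /\ (forall x, A x -> B x) /\ r = v B) (gam A).
Proof.
  apply inf_R_glb with (C := 0) (r0 := v (@setX X)).
  - exists (@setX X). split; [exact S_of_setX|]. split; [|reflexivity]. intros; exact I.
  - intros r [B [_ [_ ->]]]. apply GammaS_nonneg.
Qed.

Lemma Gamma_le A B : S_of D B -> (forall x, A x -> B x) -> gam A <= v B.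
Proof. intros HB H. apply (proj1 (Gamma_is_glb A)). exists B. auto. Qed.

Lemma Gamma_ge A c :
  (forall B, S_of D B -> (forall x, A x -> B x) -> c <= v B) -> c <= gam A.
Proof.
  intros H. apply (proj2 (Gamma_is_glb A)). intros r [B [HB [HAB ->]]]. auto.
Qed.

Lemma Gamma_approx A eps :
  0 < eps -> exists B, S_of D B /\ (forall x, A x -> B x) /\ v B < gam A + eps.
Proof.
  intros He. apply NNPP. intros Hno.
  enough (gam A + eps <= gam A) by lra.
  apply Gamma_ge. intros B HB HAB. apply Rnot_lt_le. intros H. apply Hno. exists B. auto.
Qed.

Lemma Gamma_mono : monotone_set_fun gam.
Proof. intros A B H. apply Gamma_ge. intros C HC HBC. apply Gamma_le; auto. Qed.

Lemma Gamma_S_of B : S_of D B -> gam B = v B.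
Proof.
  intros HB. apply Rle_antisym; [apply Gamma_le; auto|].
  apply Gamma_ge. intros C _ HBC. apply GammaS_mono, HBC.
Qed.

Lemma Gamma_empty : gam (fun _ => False) = 0.
Proof. rewrite Gamma_S_of by exact S_of_empty. exact GammaS_empty. Qed.

Lemma Gamma_nonneg A : 0 <= gam A.
Proof. rewrite <- Gamma_empty. apply Gamma_mono. tauto. Qed.

(* With [k] nearly optimal for [B], the set [{k < delta * chi}] lies in [S],
   contains the complement of [B], and does not meet the support of
   [(k - delta * chi)^+], whose value under [l] is still close to [v B]. *)
Lemma Gamma_compl_S_of B : S_of D B -> gam B + gam (fun x => ~ B x) <= gam (@setX X).
Proof.
  intros HB. rewrite (Gamma_S_of B HB), (Gamma_S_of _ S_of_setX).
  assert (Hlchi : 0 <= l chi).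
  { apply Hpos; [exact Hchi|]. intros x. apply Rlt_le, Hchipos. }
  (* One [eps] pays for the near-optimal [k], and [eps * l chi] for lowering [k] by [eps * chi]. *)
  apply le_eps with (c := 1 + l chi); [lra|]. intros eps He.
  destruct (GammaS_approx B eps He) as [k [(Hk & Hk1 & HkB) Hkv]].
  pose proof (D_scal eps chi Hchi) as Hec.
  set (G := fun x => 0 < eps * chi x - k x).
  assert (HG : S_of D G).
  { exists (fun x => eps * chi x - k x). split; [apply D_minus; assumption|]. tauto. }
  assert (HGle : gam (fun x => ~ B x) <= v G).
  { apply Gamma_le; [exact HG|]. intros x Hx. unfold G.
    assert (k x <= 0) by (apply Rnot_lt_le; intros H; exact (Hx (HkB x H))).
    pose proof (Rmult_lt_0_compat _ _ He (Hchipos x)). lra. }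
  set (k' := fun x => Rmax (k x - eps * chi x) 0).
  assert (Hk' : D k') by (apply D_pos_part, D_minus; assumption).
  assert (Hlk : l k <= l k' + eps * l chi).
  { rewrite <- l_scal, <- l_plus by assumption.
    apply l_le; [assumption|apply D_plus; assumption|]. intros x. unfold k'.
    pose proof (Rmax_l (k x - eps * chi x) 0). lra. }
  enough (v G <= v (@setX X) - l k') by lra.
  apply GammaS_le. intros h (Hh & Hh1 & HhG).
  (* [h] vanishes wherever [k'] is positive, so [h + k'] is still at most 1 and competes in the
     supremum for the whole space. *)
  enough (l (fun x => h x + k' x) <= v (@setX X)) by (rewrite l_plus in *; auto; lra).
  apply GammaS_ge. split; [apply D_plus; assumption|]. split; [|intros; exact I].
  intros x. unfold k'. specialize (Hh1 x). specialize (Hk1 x). specialize (HhG x).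
  pose proof (Rmult_lt_0_compat _ _ He (Hchipos x)).
  unfold G in HhG. unfold Rmax. destruct Rle_dec; [lra|].
  assert (h x <= 0) by (apply Rnot_lt_le; intros H'; specialize (HhG H'); lra). lra.
Qed.

(** * Strong subadditivity from continuity at the empty set *)

Hypothesis (Hcont : continuous_at_empty (alg_gen (S_of D)) gam).

(* Given [h] subordinate to [A \/ B], cut it as [h = a0 + b0 + r] with
   [a0 = min h (n g1)], [b0 = min (h - a0) (n g2)] and [r] supported in
   [{h > n (g1 + g2)}], which decreases to the empty set.  For [k] subordinate
   to [A /\ B], [a0 + b0 + k = max a0 k + (b0 + min k a0)] with the summands
   subordinate to [A] and [B]. *)
Lemma GammaS_strongly_subadditive : strongly_subadditive (S_of D) v.
Proof.
  intros A B HA HB.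
  destruct (S_of_nonneg A HA) as (g1 & Hg1 & Hg1p & HA1).
  destruct (S_of_nonneg B HB) as (g2 & Hg2 & Hg2p & HB1).
  (* One [eps] each for [h], for [k] and for the remainder [r]. *)
  apply le_eps with (c := 3); [lra|]. intros eps He.
  destruct (GammaS_approx (fun x => A x \/ B x) eps He) as [h [(Hh & Hh1 & HhAB) Hhv]].
  destruct (GammaS_approx (fun x => A x /\ B x) eps He) as [k [(Hk & Hk1 & HkAB) Hkv]].
  set (E := fun n x => 0 < h x - INR n * (g1 x + g2 x)).
  assert (HE : forall n, S_of D (E n)).
  { intros n. exists (fun x => h x - INR n * (g1 x + g2 x)). split; [|tauto].
    apply D_minus; [exact Hh|]. apply D_scal, D_plus; assumption. }
  destruct (Hcont E) with (eps := eps) as [n Hn]; [| | |exact He|].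
  { intros n. apply ag_base, HE. }
  { intros n x. unfold E. rewrite S_INR. specialize (Hg1p x). specialize (Hg2p x). nra. }
  (* A point of all [E n] has [h > 0], hence lies in [A] or [B], where [g1 + g2 > 0]. Once [n]
     exceeds the reciprocal of [g1 + g2], the bound [h <= 1] is contradicted. *)
  { intros x Hx. pose proof (Hx 0%nat) as H0. unfold E in H0, Hx. simpl in H0.
    assert (Hg : 0 < g1 x + g2 x).
    { specialize (Hg1p x). specialize (Hg2p x).
      destruct (HhAB x ltac:(lra)) as [H|H]; [apply HA1 in H|apply HB1 in H]; lra. }
    destruct (INR_unbounded (/ (g1 x + g2 x))) as [n Hn].
    specialize (Hx n). specialize (Hh1 x).
    apply (Rmult_lt_compat_r _ _ _ Hg) in Hn. rewrite Rinv_l in Hn by lra. lra. }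
  specialize (Hn n (le_n n)). unfold Rdist in Hn. rewrite Rminus_0_r in Hn.
  pose proof (Rle_abs (gam (E n))) as Hn'. rewrite (Gamma_S_of _ (HE n)) in Hn, Hn'.
  set (N := INR n) in *. assert (HN : 0 <= N) by apply pos_INR.
  set (a0 := fun x => Rmin (h x) (N * g1 x)).
  assert (Ha0 : D a0) by (apply D_min; [|apply D_scal]; assumption).
  set (b0 := fun x => Rmin (h x - a0 x) (N * g2 x)).
  assert (Hb0 : D b0) by (apply D_min; [apply D_minus|apply D_scal]; assumption).
  set (r := fun x => (h x - a0 x) - b0 x).
  assert (Hr : D r) by (repeat apply D_minus; assumption).
  set (a := fun x => Rmax (a0 x) (k x)).
  assert (Ha : D a) by (apply D_max; assumption).
  set (b := fun x => b0 x + Rmin (k x) (a0 x)).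
  assert (Hb : D b) by (apply D_plus; [|apply D_min]; assumption).
  assert (HG1 : forall x, 0 <= N * g1 x) by (intros x; apply Rmult_le_pos; auto).
  assert (HG2 : forall x, 0 <= N * g2 x) by (intros x; apply Rmult_le_pos; auto).
  assert (HP1 : forall x, 0 < N * g1 x -> A x).
  { intros x Hx. apply HA1. destruct (Hg1p x) as [|H]; [assumption|]. rewrite <- H in Hx. lra. }
  assert (HP2 : forall x, 0 < N * g2 x -> B x).
  { intros x Hx. apply HB1. destruct (Hg2p x) as [|H]; [assumption|]. rewrite <- H in Hx. lra. }
  assert (Hsa : subordinate a A).
  { split; [exact Ha|]. split; intros x; specialize (Hh1 x); specialize (Hk1 x);
      specialize (HG1 x); unfold a, a0.
    - unfold Rmax, Rmin. repeat destruct Rle_dec; lra.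
    - intros H. destruct (Rlt_le_dec 0 (k x)) as [H'|H']; [apply HkAB, H'|].
      apply HP1. revert H. unfold Rmax, Rmin. repeat destruct Rle_dec; lra. }
  assert (Hsb : subordinate b B).
  { split; [exact Hb|]. split; intros x; specialize (Hh1 x); specialize (Hk1 x);
      specialize (HG1 x); specialize (HG2 x); unfold b, b0, a0.
    (* [b0 <= h - a0] and [min k a0 <= a0], so [b <= h <= 1]. *)
    - unfold Rmin. repeat destruct Rle_dec; lra.
    - intros H. destruct (Rlt_le_dec 0 (k x)) as [H'|H']; [apply HkAB, H'|].
      apply HP2. revert H. unfold Rmin. repeat destruct Rle_dec; lra. }
  assert (Hsr : subordinate r (E n)).
  { split; [exact Hr|]. split; intros x; specialize (Hh1 x);
      specialize (HG1 x); specialize (HG2 x); unfold r, b0, a0, E; fold N.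
    - unfold Rmin. repeat destruct Rle_dec; lra.
    (* Where [r > 0], both minima equal their second arguments, so [r = h - N * (g1 + g2)] there. *)
    - unfold Rmin. repeat destruct Rle_dec; lra. }
  assert (Hsum : l h + l k = l a + l b + l r).
  { rewrite <- (l_plus h k), <- (l_plus a b), <- (l_plus (fun x => a x + b x) r)
      by first [assumption | apply D_plus; assumption].
    f_equal.
    apply functional_extensionality. intros x. unfold a, b, r.
    unfold Rmax, Rmin at 1. repeat destruct Rle_dec; lra. }
  apply GammaS_ge in Hsa, Hsb, Hsr. lra.
Qed.

(** The union and the intersection of near-optimal covers of [A] and [B] are again in [S_of D] and
    cover the union and the intersection. Each cover costs one [eps]. *)
Lemma Gamma_strongly_subadditive : strongly_subadditive (fun _ => True) gam.
Proof.
  intros A B _ _. apply le_eps with (c := 2); [lra|]. intros eps He.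
  destruct (Gamma_approx A eps He) as (A' & HA & HAA & HvA).
  destruct (Gamma_approx B eps He) as (B' & HB & HBB & HvB).
  pose proof (GammaS_strongly_subadditive A' B' HA HB) as H.
  assert (H1 : gam (fun x => A x \/ B x) <= v (fun x => A' x \/ B' x)).
  { apply Gamma_le; [apply S_of_union; assumption|]. intros x [Hx|Hx]; auto. }
  assert (H2 : gam (fun x => A x /\ B x) <= v (fun x => A' x /\ B' x)).
  { apply Gamma_le; [apply S_of_inter; assumption|]. intros x [Hx Hx']; auto. }
  lra.
Qed.

Lemma Gamma_countably_additive : countably_additive (alg_gen (S_of D)) gam.
Proof.
  apply continuous_at_empty_countably_additive; [|exact Hcont].
  apply strongly_subadditive_finitely_additive.
  - exact Gamma_strongly_subadditive.
  - exact Gamma_empty.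
  - exact Gamma_compl_S_of.
Qed.

End Content.

(** * Absolute continuity and weighted series of measures *)

Lemma abs_cont_continuous_at_empty (X : Type) (Alg : (X -> Prop) -> Prop)
    (mu m : (X -> Prop) -> R) :
  (forall A, 0 <= mu A) -> abs_cont Alg mu m ->
  continuous_at_empty Alg m -> continuous_at_empty Alg mu.
Proof.
  intros Hmu Hac Hm E HE Hdec Hemp eps He.
  destruct (Hac eps He) as (delta & Hd & Hdelta).
  destruct (Hm E HE Hdec Hemp delta Hd) as [N HN].
  exists N. intros n Hn. specialize (HN n Hn). unfold Rdist in *.
  rewrite Rminus_0_r in *. rewrite Rabs_pos_eq by apply Hmu.
  apply Hdelta; [apply HE|]. exact (Rle_lt_trans _ _ _ (Rle_abs _) HN).
Qed.

(** Comparison with the geometric series gives convergence, without which [series] would be an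
    arbitrary real. *)
Lemma series_geometric_bound (u : nat -> R) :
  (forall n, 0 <= u n <= (/ 2) ^ n) -> infinite_sum u (series u).
Proof.
  intros Hu. unfold series. apply epsilon_spec.
  destruct (Rseries_CV_comp u (fun n => 1 * (/ 2) ^ n)) as [s Hs].
  - intros n. rewrite Rmult_1_l. apply Hu.
  - exists (/ (1 - / 2)). apply GP_infinite. rewrite Rabs_pos_eq; lra.
  - exists s. exact Hs.
Qed.

(** Monotonicity and the divisor [1 + mu n setX] keep the n-th term below its geometric weight, so
    the series converges for every set, in the algebra or not. *)
Lemma weighted_series_finite_measure (X : Type) (S0 : (X -> Prop) -> Prop)
    (mu : nat -> (X -> Prop) -> R) :
  (forall n A, 0 <= mu n A) -> (forall n, monotone_set_fun (mu n)) ->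
  (forall n, countably_additive (alg_gen S0) (mu n)) ->
  finite_measure_on (alg_gen S0)
    (fun A => series (fun n => (/ 2) ^ S n * (mu n A / (1 + mu n (@setX X))))).
Proof.
  intros Hpos Hmono Hca.
  set (c := fun n => (/ 2) ^ S n / (1 + mu n (@setX X))).
  assert (Hc : forall n, 0 <= c n).
  { intros n. unfold c. apply Rmult_le_pos; [apply pow_le; lra|].
    apply Rlt_le, Rinv_0_lt_compat. pose proof (Hpos n (@setX X)). lra. }
  assert (Hterm : forall n A,
    (/ 2) ^ S n * (mu n A / (1 + mu n (@setX X))) = c n * mu n A).
  { intros n A. unfold c. field. pose proof (Hpos n (@setX X)). lra. }
  assert (Hsum : forall A, infinite_sum (fun n => c n * mu n A)
    (series (fun n => (/ 2) ^ S n * (mu n A / (1 + mu n (@setX X)))))).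
  { intros A. replace (fun n => c n * mu n A)
      with (fun n => (/ 2) ^ S n * (mu n A / (1 + mu n (@setX X))))
      by (apply functional_extensionality; intros n; apply Hterm).
    apply series_geometric_bound. intros n. rewrite Hterm. split.
    - apply Rmult_le_pos; auto.
    - assert (HA : mu n A <= mu n (@setX X)) by (apply Hmono; intros; exact I).
      apply Rle_trans with (c n * (1 + mu n (@setX X))).
      + apply Rmult_le_compat_l; [apply Hc|lra].
      + replace (c n * (1 + mu n (@setX X))) with ((/ 2) ^ S n)
          by (unfold c; field; pose proof (Hpos n (@setX X)); lra).
        simpl. pose proof (pow_le (/ 2) n ltac:(lra)). lra. }
  split.
  - intros A _. apply Rle_trans with (sum_f_R0 (fun n => c n * mu n A) 0).
    + simpl. apply Rmult_le_pos; auto.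
    + apply infinite_sum_pos_le; [|apply Hsum]. intros n. apply Rmult_le_pos; auto.
  - intros A HA Hdisj HU.
    (* Rows are indexed by the measures, columns by the disjoint sets: row sums converge by
       countable additivity of [mu k], column sums by the geometric bound. *)
    apply (infinite_sum_exchange (fun k n => c k * mu k (A n))
             (fun k => c k * mu k (fun x => exists n, A n x))).
    + intros k n. apply Rmult_le_pos; auto.
    + intros k eps He.
      pose proof (CV_mult _ _ _ _ (Un_cv_const (c k)) (Hca k A HA Hdisj HU)) as H.
      destruct (H eps He) as [N HN]. exists N. intros n Hn.
      specialize (HN n Hn). cbv beta in HN. rewrite scal_sum in HN.
      rewrite (sum_eq _ (fun i => mu k (A i) * c k) n) by (intros; ring). exact HN.
    + apply Hsum.
    + intros n. apply Hsum.
Qed.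

Theorem theoremT (X : Type) (D : (X -> R) -> Prop)
  (L : (X -> R) -> (X -> R) -> (X -> R) -> R)
  (HD : bdd_function_algebra D) (HStone : stone_property D)
  (chi : X -> R) (Hchi : D chi) (Hchipos : forall x, 0 < chi x)
  (HL : Lagrangian D L) :
  ((exists m : (X -> Prop) -> R,
      finite_measure_on (alg_gen (S_of D)) m /\ energy_dominant D L m) ->
   forall f, D f -> countably_additive (alg_gen (S_of D)) (Gamma D L f))
  /\
  (forall fs : nat -> X -> R,
     energy_separable D L fs ->
     (forall n, countably_additive (alg_gen (S_of D)) (Gamma D L (fs n))) ->
     finite_measure_on (alg_gen (S_of D)) (nu_of D L fs) /\
     energy_dominant D L (nu_of D L fs)).
Proof.
  destruct HL as (Hlb & _ & _ & HT1 & Hpos & _).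
  split.
  - intros (m & (_ & Hm) & Hdom) f Hf.
    destruct (Hlb f f Hf Hf) as [Hlin Hbdd].
    apply (Gamma_countably_additive X D L f chi); auto.
    apply abs_cont_continuous_at_empty with m.
    + apply (Gamma_nonneg X D L f chi); auto.
    + apply Hdom, Hf.
    + apply countably_additive_continuous_at_empty, Hm.
  - intros fs [Hfs Hsep] Hca. split; [|exact Hsep].
    apply (weighted_series_finite_measure X (S_of D) (fun n => Gamma D L (fs n))).
    + intros n. destruct (Hlb _ _ (Hfs n) (Hfs n)) as [Hlin Hbdd].
      apply (Gamma_nonneg X D L (fs n) chi); auto.
    + intros n. destruct (Hlb _ _ (Hfs n) (Hfs n)) as [Hlin Hbdd].
      apply (Gamma_mono X D L (fs n) chi); auto.
    + exact Hca.
Qed.
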